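(* Let $p$ be an odd prime and let $f(z)=z^p+c$ with $c\in\mathbb{Z}\setminus\{0\}$. Over $\mathbb{Q}(\zeta_p)$, $f(z)$ is stable if $c$ is not of the form $r^p$, $r\in\mathbb{Z}$. Otherwise, writing $c=r^p$ with $r\in\mathbb{Z}$, $f(z)$ is the product of the $p$ linear polynomials $g_i(z)=z+r\zeta_p^i$, $i=0,\ldots,p-1$, and $g_i(f^n(z))$ is irreducible over $\mathbb{Q}(\zeta_p)$ for all $n\ge1$ and all $i$. Over $\mathbb{Q}$, $f(z)$ is stable if $c$ is not of the form $r^p$, $r\in\mathbb{Z}$. Otherwise, with $c=r^p$, $f(z)=(z+r)h(z)$ for some irreducible $h(z)\in\mathbb{Z}[z]$, and $f^n(z)+r$ and $h(f^n(z))$ are both irreducible over $\mathbb{Q}$ for all $n\ge1$.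
   Context: $f^n$ denotes the $n$th iterate of $f$, and $\zeta_p$ is a primitive $p$th root of unity. A polynomial $f$ is stable over a field $K$ if $f^n$ is irreducible over $K$ for all $n\ge1$. *)

(* Defs.v *)
From HB Require Import structures.
From mathcomp Require Import all_boot all_order all_algebra all_field.

Set Implicit Arguments.
Unset Strict Implicit.
Unset Printing Implicit Defensive.

Import GRing.Theory.
Local Open Scope ring_scope.

Definition unicritical (R : comNzRingType) (p : nat) (c : R) : {poly R} :=
  'X^p + c%:P.

Definition poly_iter (R : comNzRingType) (f : {poly R}) (n : nat) : {poly R} :=
  iter n (fun q => f \Po q) 'X.

Definition stable_poly (K : fieldType) (f : {poly K}) : Prop :=
  forall n : nat, (0 < n)%N -> irreducible_poly (poly_iter f n).

(* The extension L of Q is a model of the cyclotomic field Q(zeta_p), with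
   zeta in the role of zeta_p: [<<1; zeta>>] is the subfield that zeta
   generates over the prime field. *)
Definition cyclotomic_field (p : nat) (L : fieldExtType rat) (zeta : L) : Prop :=
  p.-primitive_root zeta /\ <<1; zeta>>%VS = fullv.

Lemma cyclotomic_field_exists (p : nat) : (0 < p)%N ->
  exists (L : fieldExtType rat) (zeta : L), cyclotomic_field p zeta.
Proof.
move=> p0; have [w wp] := C_prim_root_exists p0.
have [L [LC [s [def_w genL]]]] := num_field_exists [:: w].
case: s def_w genL => [|z [|]] //= [def_w] genL; exists L, z; split.
  by rewrite -(fmorph_primitive_root LC) def_w.
by rewrite -genL adjoin_seq1.
Qed.

(* Main.v *)
Require Import Defs.
From HB Require Import structures.
From mathcomp Require Import all_boot all_order all_algebra all_field zify.

Set Implicit Arguments.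
Unset Strict Implicit.
Unset Printing Implicit Defensive.

Import GRing.Theory Num.Theory.
Local Open Scope ring_scope.

(** Irreducibility along a tower. If [g] is monic and irreducible over a field
    [K], then [g] composed with the [n]-th iterate of [f = 'X^p + c] stays
    irreducible for all [n] as soon as none of the values
    [g(f(0)), g(f(f(0))), ...] is a [p]-th power in [K]
    ([irreducible_comp_iter]). This is Capelli's lemma ([capelli]) applied one
    level at a time: if [h] is irreducible with root [b], then [h(f)] is
    irreducible once ['X^p - (b - c)] is irreducible over [K(b)], that is, once
    [b - c] is not a [p]-th power in [K(b)]; and the norm of [b - c] down to
    [K] is [h(c)] up to sign.

    For [K = Q(zeta)] it remains to see that certain elements are not [p]-th
    powers. Write [a] for one of the terms [f(0), f(f(0)), ...] of the
    critical orbit; it has the form [c * b] with [b] prime to [c]. An integer that is a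
    [p]-th power in [K] is one in [Z], because [[K : Q] = p - 1] is prime to
    [p].

    - If [c] is not a [p]-th power, neither is [c * b], by coprimality.
    - If [c = r ^ p], the linear factors of [f] lead to the elements
      [a + r * zeta ^ i = r * (t + zeta ^ i)], where [r] divides [t]. For
      [i = 0] the integer [a + r] lies strictly between two consecutive [p]-th
      powers ([critical_orbit_not_power]). For [i <> 0], suppose that
      [r * (t + zeta ^ i)] is a [p]-th power. The norm of [t + zeta ^ i] is
      prime to [r], so [r] is a [p]-th power ([pth_power_of_twisted]), hence so
      is [t + zeta ^ i]. But a [p]-th power in [Z[zeta]] is congruent to an
      integer modulo [p], which [t + zeta ^ i] is not
      ([not_pth_power_unit_shift]). The [p]-th root is only known to lie in
      [K]; a descent along powers of [zeta - 1] puts it in the localization of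
      [Z[zeta]] at [p] ([local_integral_of_pth_power]), which is enough, in
      place of a determination of the ring of integers of [K].

    Over [Q], irreducibility over [K] implies irreducibility for the iterates
    and for [f^n + r]. The cofactor [h] is the cyclotomic polynomial up to a
    linear change of variable, and [h(f^n)] is handled by Capelli's lemma for
    the root [- r * zeta] of [h], since [f^n + r * zeta] is irreducible over
    [K]. *)

(** * Capelli's lemma *)

(** The expansion of [A] in base [u], obtained by repeated Euclidean division;
    the digits, of degree smaller than that of [u], are transposed so that [a j]
    collects their coefficients of ['X^j]. *)
Lemma digit_expansion (F : fieldType) (u : {poly F}) : (1 < size u)%N ->
  forall A : {poly F}, exists a : nat -> {poly F},
    A = \sum_(j < (size u).-1) (a j \Po u) * 'X^j.
Proof.
move=> u_gt1 A; have [m] := ubnP (size A).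
elim: m A => // m IHm A; rewrite ltnS => szA.
have u_neq0 : u != 0 by rewrite -size_poly_eq0 -lt0n ltnW.
have [A0|A_neq0] := eqVneq A 0.
  exists (fun=> 0); rewrite A0 big1 // => j _; by rewrite comp_poly0 mul0r.
have szq : (size (A %/ u)%R < m)%N.
  apply: leq_trans szA; rewrite size_divp //.
  rewrite ltn_subrL size_poly_gt0 A_neq0 andbT; by case: (size u) u_gt1 => [|[]].
have [b def_q] := IHm _ szq.
exists (fun j => b j * 'X + ((A %% u)%R`_j)%:P).
rewrite [LHS](divp_eq A u) {1}def_q mulr_suml.
have szr : (size (A %% u)%R <= (size u).-1)%N.
  by rewrite -ltnS prednK ?(ltnW u_gt1) // ltn_modp.
have {1}-> : (A %% u)%R = \sum_(j < (size u).-1) (A %% u)%R`_j *: 'X^j.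
  rewrite -(poly_def _ (fun j => (A %% u)%R`_j)); apply/polyP => i.
  rewrite coef_poly; case: ltnP => // le_i.
  by rewrite nth_default // (leq_trans szr).
rewrite -big_split; apply: eq_bigr => j _ /=.
rewrite comp_polyD comp_polyM comp_polyX comp_polyC mulrDl mul_polyC.
by congr (_ + _); rewrite -!mulrA [_ * u]mulrC.
Qed.

Lemma irreducible_dvd_root (F K : fieldType) (f : {rmorphism F -> K})
    (h A : {poly F}) (x : K) :
  irreducible_poly h -> root (map_poly f h) x -> root (map_poly f A) x -> h %| A.
Proof.
move=> h_irr hx Ax; apply: contraT.
rewrite -irreducible_poly_coprime // -(coprimep_map f).
by move/coprimep_root => /(_ x hx); rewrite -rootE Ax.
Qed.

(** Reducing the base-[u] expansion of [A] modulo [u - x] replaces each [a j (u)]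
    by the constant [a j (x)], and leaves a polynomial of degree smaller than
    that of [u], so divisibility makes all these constants vanish. Hence [h],
    the minimal polynomial of [x], divides every [a j]. *)
Lemma dvdp_comp_of_fiber (F K : fieldType) (f : {rmorphism F -> K})
    (h u A : {poly F}) (x : K) :
  irreducible_poly h -> root (map_poly f h) x -> (1 < size u)%N ->
  map_poly f u - x%:P %| map_poly f A -> h \Po u %| A.
Proof.
move=> h_irr hx u_gt1 dvd_A.
have [a def_A] := digit_expansion u_gt1 A.
pose v := map_poly f u - x%:P.
have szv : size v = size u.
  rewrite size_polyDl ?size_map_poly // size_polyN.
  exact: leq_ltn_trans (size_polyC_leq1 _) u_gt1.
pose b j := (map_poly f (a j)).[x].
have dvd_b j : v %| (map_poly f (a j) \Po map_poly f u) - (b j)%:P.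
  have /factor_theorem[q def_q] : root (map_poly f (a j) - (b j)%:P) x.
    by rewrite rootE !hornerE subrr.
  have -> : (map_poly f (a j) \Po map_poly f u) - (b j)%:P
     = (map_poly f (a j) - (b j)%:P) \Po map_poly f u.
    by rewrite comp_polyB comp_polyC.
  by rewrite def_q comp_polyM comp_polyB comp_polyX comp_polyC dvdp_mull.
pose B := \sum_(j < (size u).-1) b j *: 'X^j.
have v_dvd_B : v %| B.
  have -> : B = map_poly f A -
      \sum_(j < (size u).-1)
         ((map_poly f (a j) \Po map_poly f u) - (b j)%:P) * 'X^j.
    rewrite {1}def_A rmorph_sum -sumrB; apply: eq_bigr => j _ /=.
    rewrite rmorphM /= map_comp_poly map_polyXn mulrBl opprB addrCA subrr addr0.
    by rewrite mul_polyC.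
  rewrite dvdp_sub //; apply: (big_ind (fun p : {poly K} => v %| p)) => [|p q|j _].
  - exact: dvdp0.
  - exact: dvdp_add.
  - exact: dvdp_mulr.
have B0 : B = 0.
  apply: contraTeq v_dvd_B => B_neq0; rewrite gtNdvdp // szv.
  rewrite /B -(poly_def _ b) (leq_ltn_trans (size_poly _ _)) //.
  by rewrite prednK // ltnW.
have b0 (j : 'I_(size u).-1) : b j = 0.
  have := congr1 (fun q : {poly K} => q`_j) B0.
  by rewrite /B -(poly_def _ b) coef_poly ltn_ord coef0.
rewrite def_A; apply: (big_ind (fun p : {poly F} => h \Po u %| p)) => [|p q|j _].
- exact: dvdp0.
- exact: dvdp_add.
have /dvdpP[q ->] : h %| a j.
  by apply: (irreducible_dvd_root h_irr hx); rewrite rootE [_.[x]]b0.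
by rewrite comp_polyM -mulrA dvdp_mull // dvdp_mulr.
Qed.

(** Capelli's lemma. In a factorization of [h \Po u] over [F], the irreducible
    polynomial [u - x] divides one of the factors over [K], so [h \Po u] itself
    divides that factor by [dvdp_comp_of_fiber]. *)
Lemma capelli (F K : fieldType) (f : {rmorphism F -> K})
    (h u : {poly F}) (x : K) :
  irreducible_poly h -> root (map_poly f h) x ->
  irreducible_poly (map_poly f u - x%:P) -> irreducible_poly (h \Po u).
Proof.
move=> h_irr hx v_irr; have h_gt1 := h_irr.1.
have u_gt1 : (1 < size u)%N.
  rewrite ltnNge; apply: contraL v_irr.1 => u_le1; rewrite -leqNgt.
  rewrite (leq_trans (size_polyD _ _)) // geq_max size_map_poly u_le1 size_polyN.
  exact: size_polyC_leq1.
have hu_gt1 : (1 < size (h \Po u))%N.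
  rewrite ltnNge -subn_eq0 subn1 size_comp_poly muln_eq0 -!subn1 !subn_eq0.
  by rewrite negb_or -!ltnNge h_gt1 u_gt1.
have hu_neq0 : h \Po u != 0 by rewrite -size_poly_eq0 -lt0n ltnW.
split=> // A A_neq1 /dvdpP[B def_hu].
have AB_neq0 : B * A != 0 by rewrite -def_hu.
move: (AB_neq0); rewrite mulf_eq0 negb_or => /andP[B_neq0 A_neq0].
have: map_poly f u - x%:P %| map_poly f (B * A).
  rewrite -def_hu map_comp_poly.
  have /factor_theorem[q ->] := hx.
  by rewrite comp_polyM comp_polyB comp_polyX comp_polyC dvdp_mull.
rewrite rmorphM /=; case: (boolP (map_poly f u - x%:P %| map_poly f B)) => [dvdB _|].
  have := dvdp_leq B_neq0 (dvdp_comp_of_fiber h_irr hx u_gt1 dvdB).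
  rewrite def_hu size_mul // => le_sz; case/negP: A_neq1.
  have := A_neq0; rewrite -size_poly_gt0 => A_gt0.
  move: le_sz A_gt0 B_neq0; rewrite -size_poly_gt0; lia.
rewrite -irreducible_poly_coprime // => cop; rewrite Gauss_dvdpr // => dvdA.
rewrite /eqp (dvdp_comp_of_fiber h_irr hx u_gt1 dvdA) andbT.
by rewrite def_hu dvdp_mull.
Qed.

(** * Norms by companion matrices and binomial polynomials *)

Lemma exprN_odd (R : comNzRingType) (p : nat) (x : R) :
  odd p -> (- x) ^+ p = - x ^+ p.
Proof. by move=> p_odd; rewrite exprNn -signr_odd p_odd mulN1r. Qed.

(** Norms from [R['X] / (h)] are computed as determinants: for a matrix [C] with
    characteristic polynomial [h], the norm of the class of [P] is
    [\det (horner_mx C P)]. The companion matrix of [h] has the right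
    characteristic polynomial; the index type is recast into the successor form
    on which [horner_mx] is defined. *)
Lemma exists_char_poly (R : comNzRingType) (h : {poly R}) :
  h \is monic -> (1 < size h)%N ->
  exists C : 'M[R]_((size h).-2.+1), char_poly C = h.
Proof.
move=> h_mon h_gt1; have e : (size h).-1 = (size h).-2.+1.
  by case: (size h) h_gt1 => [|[]].
exists (castmx (e, e) (companionmx h)).
rewrite -[RHS](companionmxK h_mon).
by move: (companionmx h); rewrite -?e; case: _ / e => C; rewrite castmx_id.
Qed.

Lemma horner_mx_congr (R : comNzRingType) (n : nat) (C : 'M[R]_n.+1)
    (P Q S : {poly R}) :
  P - Q = S * char_poly C -> horner_mx C P = horner_mx C Q.
Proof.
move=> def_PQ; apply/eqP; rewrite -subr_eq0 -rmorphB /= def_PQ.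
by rewrite rmorphM /= Cayley_Hamilton mulr0.
Qed.

Lemma det_horner_mx_subX (R : comNzRingType) (n : nat) (C : 'M[R]_n.+1) (a : R) :
  \det (horner_mx C ('X - a%:P)) = (-1) ^+ n.+1 * (char_poly C).[a].
Proof.
rewrite rmorphB /= horner_mx_X horner_mx_C -opprB -scaleN1r detZ; congr (_ * _).
rewrite /char_poly -horner_evalE -det_map_mx; congr (\det _).
apply/matrixP => i j; rewrite !mxE /= horner_evalE.
by rewrite hornerD hornerN hornerC hornerMn hornerX.
Qed.

Lemma det_horner_mxX (R : comNzRingType) (n k : nat) (C : 'M[R]_n.+1) (P : {poly R}) :
  \det (horner_mx C (P ^+ k)) = \det (horner_mx C P) ^+ k.
Proof.
elim: k => [|k IHk]; first by rewrite !expr0 rmorph1 det1.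
by rewrite !exprS rmorphM /= detM IHk.
Qed.

(** Bezout: if [u * k = v * p + 1] then [a ^+ (v * p + 1)] is a [p]-th power. *)
Lemma pth_power_of_coprime_power (M : fieldType) (p k : nat) (a N : M) :
  prime p -> (0 < k < p)%N -> a ^+ k = N ^+ p -> exists b, a = b ^+ p.
Proof.
move=> p_pr /andP[k_gt0 k_ltp] aN.
have [a0|a_neq0] := eqVneq a 0.
  by exists 0; rewrite a0 expr0n gtn_eqF ?prime_gt0.
have co : coprime k p by rewrite coprime_sym prime_coprime // gtnNdvd.
have [u v uv _] := egcdnP p k_gt0.
exists (N ^+ u / a ^+ v).
rewrite expr_div_n -!exprM [(u * p)%N]mulnC exprM -aN -exprM.
rewrite [(k * u)%N]mulnC uv (eqP co) exprD expr1 mulrAC divff ?mul1r //.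
by rewrite expf_neq0.
Qed.

(** For a factor of degree [k], with [0 < k < p], the norm of ['X] modulo that
    factor has [p]-th power [a ^+ k], which makes [a] itself a [p]-th power. *)
Lemma irreducible_XnsubC (M : fieldType) (p : nat) (a : M) :
  prime p -> ~ (exists b, a = b ^+ p) -> irreducible_poly ('X^p - a%:P).
Proof.
move=> p_pr not_pow; have p_gt0 := prime_gt0 p_pr.
have sz := size_XnsubC a p_gt0.
have nz : 'X^p - a%:P != 0 by rewrite -size_poly_eq0 sz.
split=> [|A szA dvdA]; first by rewrite sz ltnS.
have A_neq0 : A != 0 by apply: contraTneq dvdA => ->; rewrite dvd0p.
pose B := (lead_coef A)^-1 *: A.
have lA : (lead_coef A)^-1 != 0 by rewrite invr_eq0 lead_coef_eq0.
have B_mon : B \is monic by rewrite monicE lead_coefZ mulVf // lead_coef_eq0.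
have AB : B %= A by apply: eqp_scale.
have szB : size B = size A by apply: size_scale.
have B_gt1 : (1 < size B)%N.
  by rewrite szB ltn_neqAle eq_sym szA size_poly_gt0.
have le_sz : (size B <= p.+1)%N by rewrite szB -sz dvdp_leq.
have [C def_C] := exists_char_poly B_mon B_gt1.
have [szp|lt_sz] := eqVneq (size B) p.+1.
  by rewrite -dvdp_size_eqp // sz -szB szp.
case: not_pow.
have k_lt : (0 < (size B).-2.+1 < p)%N.
  move: lt_sz le_sz B_gt1; lia.
apply: (pth_power_of_coprime_power (N := \det (horner_mx C 'X)) p_pr k_lt).
have /dvdpP[S def_S] : B %| 'X^p - a%:P by rewrite (eqp_dvdl _ AB).
rewrite -det_horner_mxX (@horner_mx_congr _ _ _ _ a%:P S) ?def_C //.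
by rewrite horner_mx_C det_scalar.
Qed.

(** By [capelli] it is enough that [x - c] is not a [p]-th power in [K(x)], where
    [h.[x] = 0]; its norm to [K] is [h.[c]] up to sign, and the sign is harmless
    because [p] is odd. *)
Lemma irreducible_comp_unicritical (K : fieldType) (p : nat) (c : K) (h : {poly K}) :
  prime p -> odd p -> h \is monic -> irreducible_poly h ->
  ~ (exists b, h.[c] = b ^+ p) -> irreducible_poly (h \Po unicritical p c).
Proof.
move=> p_pr p_odd h_mon h_irr not_pow.
have [M _ [x hx gen_x]] := irredp_FAdjoin h_irr.
apply: (capelli h_irr hx).
rewrite /unicritical rmorphD /= map_polyXn map_polyC /=.
rewrite -addrA -polyCN -polyCD addrC -[_ + 'X^p]addrC.
have -> : (c%:A - x)%:P = - (x - c%:A)%:P by rewrite -polyCN opprB.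
apply: irreducible_XnsubC => // -[y def_y]; apply: not_pow.
have /Fadjoin_polyP[G /polyOver1P[G1 ->{G}] def_G] : y \in <<1; x>>%VS.
  by rewrite gen_x memvf.
have h_gt1 := h_irr.1; have [C def_C] := exists_char_poly h_mon h_gt1.
have /dvdpP[S def_S] : h %| G1 ^+ p - ('X - c%:P).
  apply: (irreducible_dvd_root h_irr hx).
  rewrite rootE !(rmorphB, rmorphXn) /= map_polyX map_polyC /= !hornerE.
  by rewrite -def_G -def_y subrr.
have := det_horner_mxX p C G1.
rewrite (@horner_mx_congr _ _ _ _ ('X - c%:P) S) ?def_C; last exact: def_S.
rewrite det_horner_mx_subX def_C => def_N.
exists ((-1) ^+ (size h).-2.+1 * \det (horner_mx C G1)).
rewrite exprMn -def_N mulrA -exprM mulnC exprM -(signr_odd _ p) p_odd expr1.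
by rewrite -exprMn mulrNN mulr1 expr1n mul1r.
Qed.

(** * Iterates of a unicritical polynomial *)

Lemma poly_iterS (R : comNzRingType) (f : {poly R}) n :
  poly_iter f n.+1 = poly_iter f n \Po f.
Proof.
elim: n => [|n IHn]; first by rewrite /poly_iter /= comp_polyX comp_polyXr.
by rewrite -[LHS]/(f \Po poly_iter f n.+1) [in LHS]IHn comp_polyA.
Qed.

Lemma irreducible_comp_iter (K : fieldType) (p : nat) (c : K) (g : {poly K}) :
  prime p -> odd p -> g \is monic -> irreducible_poly g ->
  (forall n, ~ exists b, g.[(poly_iter (unicritical p c) n.+1).[0]] = b ^+ p) ->
  forall n, irreducible_poly (g \Po poly_iter (unicritical p c) n).
Proof.
move=> p_pr p_odd g_mon g_irr not_pow; have p_gt0 := prime_gt0 p_pr.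
pose f := unicritical p c.
have f_mon : f \is monic by rewrite monicXnaddC.
have szf : size f = p.+1 by rewrite size_XnaddC.
have comp_mon (q : {poly K}) : q \is monic -> q \Po f \is monic.
  move=> q_mon; rewrite monicE lead_coef_comp ?szf ?ltnS // (monicP q_mon).
  by rewrite (monicP f_mon) expr1n mulr1.
suff H n : g \Po poly_iter f n \is monic /\ irreducible_poly (g \Po poly_iter f n).
  by move=> n; case: (H n).
elim: n => [|n [IHm IHi]]; first by rewrite /poly_iter /= comp_polyXr.
rewrite poly_iterS comp_polyA; split; first exact: comp_mon.
apply: irreducible_comp_unicritical => // -[b def_b]; apply: (not_pow n).
exists b; rewrite -def_b poly_iterS !horner_comp.
by rewrite /unicritical !hornerE expr0n gtn_eqF // add0r.
Qed.

(** * Integers that are perfect powers *)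

(** The part of [u] supported on the primes of [a] has [p]-th power [a]. *)
Lemma natural_coprime_root (a b u p : nat) : (0 < p)%N ->
  coprime a b -> (a * b = u ^ p)%N -> exists v : nat, a = (v ^ p)%N.
Proof.
move=> p_gt0; have [->|a_gt0] := posnP a; first by exists 0%N; rewrite exp0n.
have [->|b_gt0] := posnP b.
  by rewrite /coprime gcdn0 => /eqP-> _; exists 1%N; rewrite exp1n.
move=> co ab; exists (u`_(\pi(a)))%N.
rewrite -partnX -ab partnM // part_pnat_id ?pnat_pi // part_p'nat ?muln1 //.
by rewrite -coprime_pi'.
Qed.

Lemma int_coprime_root (a b u : int) (p : nat) : odd p ->
  coprimez a b -> a * b = u ^+ p -> exists v : int, a = v ^+ p.
Proof.
move=> p_odd co /(congr1 absz); rewrite abszM abszX => ab.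
have [v def_v] := natural_coprime_root (odd_gt0 p_odd) co ab.
exists ((-1) ^+ (a < 0)%R * v%:Z); rewrite exprMn -exprM mulnC exprM.
by rewrite -(signr_odd _ p) p_odd expr1 -[v%:Z]natz -natrX natz -def_v -intEsign.
Qed.

Lemma int_root_of_rat_root (a : int) (x : rat) (n : nat) : (0 < n)%N ->
  a%:~R = x ^+ n -> exists v : int, a = v ^+ n.
Proof.
move=> n_gt0 def_a; exists (numq x).
have def_num : numq x ^+ n = a * denq x ^+ n.
  apply/eqP; rewrite -(eqr_int rat) rmorphM /= !rmorphXn /= def_a -exprMn.
  by rewrite -numqE.
suff den1 : denq x = 1 by rewrite def_num den1 expr1n mulr1.
have: (denq x ^+ n %| numq x ^+ n)%Z by rewrite def_num dvdz_mull.
rewrite dvdz_pexp2r // => dvd_num.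
have := coprime_num_den x; rewrite /coprime; move: dvd_num.
case: (denqP x) => d -> dvd_num /eqP co.
by move/gcdn_idPr: dvd_num; rewrite co /= => <-.
Qed.

(** * Reduction of integer polynomials modulo a prime *)

Lemma poly_mod_p (p : nat) (P : {poly int}) : prime p ->
  map_poly (intr : int -> 'F_p) P = 0 -> exists W, P = p%:Z *: W.
Proof.
move=> p_pr P0; have p_ch := pchar_Fp p_pr.
exists (map_poly (fun a => (a %/ p)%Z) P); apply/polyP => i.
rewrite coefZ coef_map_id0 ?div0z // mulrC divzK // (dvdz_pcharf p_ch).
by have := congr1 (fun Q : {poly _} => Q`_i) P0; rewrite coef_map coef0 => ->.
Qed.

(** Frobenius on polynomials over the prime field: [P ^+ p] and [P \Po 'X^p]
    agree modulo [p]. *)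
Lemma frobenius_poly (p : nat) (P : {poly int}) : prime p ->
  exists W, P ^+ p = (P \Po 'X^p) + p%:Z *: W.
Proof.
move=> p_pr; have p_gt0 := prime_gt0 p_pr; have p_ch := pchar_Fp p_pr.
have p_chP : p \in [pchar {poly 'F_p}] by rewrite pchar_poly.
suff [W def_W] : exists W, P ^+ p - (P \Po 'X^p) = p%:Z *: W.
  by exists W; rewrite -def_W addrC subrK.
apply: poly_mod_p => //; rewrite rmorphB rmorphXn /= map_comp_poly map_polyXn.
elim/poly_ind: P => [|P c IHP].
  by rewrite rmorph0 comp_poly0 expr0n gtn_eqF // subrr.
rewrite rmorphD rmorphM /= map_polyX map_polyC /=.
rewrite -(pFrobenius_autE p_chP) pFrobenius_autD_comm; last exact: mulrC.
rewrite !pFrobenius_autE exprMn comp_polyD comp_polyM comp_polyX comp_polyC.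
rewrite -polyC_exp -(pFrobenius_autE p_ch) pFrobenius_aut_int.
by rewrite opprD addrACA subrr addr0 -mulrBl IHP mul0r.
Qed.

(** * The prime cyclotomic field *)

Lemma map_in_alg_intr (L : fieldExtType rat) (P : {poly int}) :
  map_poly (in_alg L) (map_poly (intr : int -> rat) P) = map_poly intr P.
Proof.
by rewrite -map_poly_comp; apply: eq_map_poly => a; apply: (rmorph_int (in_alg L)).
Qed.

Section Cyclotomic.
Variables (p : nat) (p_pr : prime p) (p_odd : odd p).
Let p_gt0 := prime_gt0 p_pr.
Let p_gt2 := odd_prime_gt2 p_odd p_pr.

Lemma mulX1_Cyclotomic : ('X - 1) * 'Phi_p = 'X^p - 1 :> {poly int}.
Proof.
have div_p : perm_eq (divisors p) [:: 1%N; p].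
  apply: uniq_perm; rewrite ?divisors_uniq //= ?inE ?andbT ?[_ == p]eq_sym.
    by rewrite gtn_eqF // prime_gt1.
  move=> d; rewrite -dvdn_divisors // !inE.
  apply/idP/idP => [|/orP[]/eqP->]; rewrite ?dvd1n //.
  by case/primeP: p_pr => _; apply.
have := @prod_Cyclotomic 1 isT; rewrite [divisors 1]/= big_seq1 expr1 => <-.
by rewrite -prod_Cyclotomic // (perm_big _ div_p) big_cons big_seq1.
Qed.

Lemma deriv_mulX1 (P : {poly int}) : (('X - 1) * P)^`() = P + ('X - 1) * P^`().
Proof. by rewrite derivM derivB derivX derivC subr0 mul1r. Qed.

Lemma Cyclotomic_at1 : ('Phi_p).[1] = p%:Z.
Proof.
have := congr1 (fun P : {poly int} => (P^`()).[1]) mulX1_Cyclotomic.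
rewrite deriv_mulX1 derivB derivXn derivC !hornerE hornerMn => ->.
by rewrite hornerXn expr1n natz.
Qed.

Lemma deriv_Cyclotomic_at1 : (p %| ('Phi_p)^`().[1])%Z.
Proof.
have := congr1 (fun P : {poly int} => (P^`()^`()).[1]) mulX1_Cyclotomic.
rewrite deriv_mulX1 derivD deriv_mulX1 derivB derivXn derivC subr0.
rewrite derivMn derivXn !(hornerD, hornerM, hornerN, hornerX, hornerC).
rewrite subrr mul0r addr0 !hornerMn hornerXn expr1n.
move=> def2; rewrite -(@Gauss_dvdzr _ 2); last by rewrite coprimezE coprimen2.
by rewrite mulrC mulr_natr mulr2n def2 -mulr_natr !natz dvdz_mull.
Qed.

(** The cyclotomic polynomial is the minimal polynomial over [rat] of a primitive
    root of unity in [algC]. *)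
Lemma irreducible_Cyclotomic :
  irreducible_poly (map_poly (intr : int -> rat) 'Phi_p).
Proof.
have [w w_prim] := C_prim_root_exists p_gt0.
have [q [def_q q_mon] dvd_q] := minCpolyP w.
have -> : map_poly intr 'Phi_p = q.
  apply: (map_poly_inj (ratr : {rmorphism rat -> algC})).
  rewrite -def_q (minCpoly_cyclotomic w_prim) -(Cintr_Cyclotomic w_prim).
  rewrite -map_poly_comp /=.
  by apply: eq_map_poly => a /=; rewrite ratr_int.
have wq : root (map_poly ratr q) w by rewrite dvd_q.
have q_neq0 := monic_neq0 q_mon.
split=> [|A A_neq1 dvdA].
  rewrite ltnNge; apply: contraTN wq => /size1_polyC def_C.
  rewrite def_C map_polyC rootC /= fmorph_eq0.
  by apply: contra q_neq0 => /eqP C0; rewrite def_C C0.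
have /dvdpP[B def_AB] := dvdA; have := wq.
rewrite def_AB rmorphM rootM !dvd_q => /orP[dvdB|]; last first.
  by rewrite -def_AB /eqp dvdA.
have := q_neq0; rewrite {1}def_AB mulf_eq0 negb_or => /andP[B_neq0 A_neq0].
have := dvdp_leq B_neq0 dvdB; rewrite def_AB size_mul //.
by move: A_neq1 A_neq0 B_neq0; rewrite -!size_poly_gt0; lia.
Qed.

Variables (L : fieldExtType rat) (z : L) (cyc : cyclotomic_field p z).
Let z_prim : p.-primitive_root z := cyc.1.

Notation ev P := (map_poly (intr : int -> L) P).[z].

Lemma subX1_neq0 : z - 1 != 0.
Proof.
by rewrite subr_eq0 -[z]expr1 -(prim_order_dvd z_prim) dvdn1 gtn_eqF ?prime_gt1.
Qed.

Lemma root_Cyclotomic : ev 'Phi_p = 0.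
Proof.
have : ev (('X - 1) * 'Phi_p) = 0.
  rewrite mulX1_Cyclotomic rmorphB /= map_polyXn rmorph1 !hornerE.
  by rewrite (prim_expr_order z_prim) subrr.
rewrite rmorphM hornerM rmorphB /= map_polyX rmorph1 !hornerE.
by move/eqP; rewrite mulf_eq0 (negPf subX1_neq0) => /eqP.
Qed.

Lemma dvd_Cyclotomic (P : {poly int}) : ev P = 0 -> exists S, P = S * 'Phi_p.
Proof.
move=> P0; apply/(Pdiv.IdomainMonic.dvdpP (Cyclotomic_monic p)); rewrite -dvdp_rat_int.
apply: (irreducible_dvd_root (f := in_alg L) (x := z) irreducible_Cyclotomic).
  by rewrite rootE map_in_alg_intr root_Cyclotomic.
by rewrite rootE map_in_alg_intr P0.
Qed.

Lemma intr_ext_eq0 (a : int) : (a%:~R == 0 :> L) = (a == 0).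
Proof. by rewrite -(rmorph_int (in_alg L)) fmorph_eq0 intr_eq0. Qed.

Lemma integral_fraction (d : L) :
  exists (P : {poly int}) (m : nat), (0 < m)%N /\ d * m%:R = ev P.
Proof.
have /Fadjoin_polyP[G /polyOver1P[G1 ->] ->] : d \in <<1; z>>%VS.
  by rewrite cyc.2 memvf.
have [Q [a a_neq0 ->]] := rat_poly_scale G1.
exists (sgz a *: Q), `|a|%N; split; first by rewrite absz_gt0.
have -> : map_poly (in_alg L) (a%:~R^-1 *: map_poly intr Q) =
          (a%:~R)^-1 *: map_poly intr Q.
  by rewrite map_polyZ map_in_alg_intr fmorphV rmorph_int.
rewrite map_polyZ !hornerZ mulrAC; congr (_ * _) => /=.
rewrite -[`|a|%:R]/(`|a|%:Z%:~R) abszEsg intrM mulrC mulfK //.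
by rewrite intr_ext_eq0.
Qed.

Lemma int_root_of_power (r u : int) (k : nat) : (0 < k < p)%N ->
  r ^+ k = u ^+ p -> exists s : int, r = s ^+ p.
Proof.
move=> k_lt def_u.
have [|b def_b] := @pth_power_of_coprime_power rat p k r%:~R u%:~R p_pr k_lt.
  by rewrite -!rmorphXn /= def_u.
exact: int_root_of_rat_root p_gt0 def_b.
Qed.

Lemma exists_Cyclotomic_matrix : exists C : 'M[int]_(p.-2.+1), char_poly C = 'Phi_p.
Proof.
have := exists_char_poly (Cyclotomic_monic p).
by rewrite size_Cyclotomic totient_prime // prednK //; apply; apply: prime_gt1.
Qed.

(** A [p]-th root [d] of [Q(z)] need not lie in [Z[z]], so the norm is applied to
    the numerator of [d]; this exhibits [\det (horner_mx C Q)] as the [p]-th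
    power of a rational number, which is then an integer. *)
Lemma norm_pth_power (C : 'M[int]_(p.-2.+1)) (d : L) (Q : {poly int}) :
  char_poly C = 'Phi_p -> d ^+ p = ev Q ->
  exists u : int, \det (horner_mx C Q) = u ^+ p.
Proof.
move=> def_C def_d; have [P [m [m_gt0 def_P]]] := integral_fraction d.
have [S def_S] : exists S, P ^+ p - (m%:Z ^+ p)%:P * Q = S * 'Phi_p.
  apply: dvd_Cyclotomic; rewrite rmorphB rmorphM rmorphXn /= map_polyC /=.
  rewrite !hornerE -def_P -def_d exprMn rmorphXn /=.
  by rewrite -pmulrn mulrC subrr.
have := det_horner_mxX p C P.
rewrite (horner_mx_congr (S := S) (Q := (m%:Z ^+ p)%:P * Q)) ?def_C //.
rewrite rmorphM detM /= horner_mx_C det_scalar -exprM => def_N.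
apply: (@int_root_of_rat_root _ ((\det (horner_mx C P))%:~R / m%:R ^+ p.-2.+1)) => //.
rewrite expr_div_n -[X in X / _]rmorphXn /= -def_N rmorphM rmorphXn /= -pmulrn.
rewrite -exprM [(_ * p)%N]mulnC [X in X / _]mulrC mulfK //.
by rewrite expf_neq0 // pnatr_eq0 -lt0n.
Qed.

(** The norm of the integer [a] is [a ^+ p.-1], and [p.-1] is prime to [p]. *)
Lemma int_pth_power (a : int) (d : L) : d ^+ p = a%:~R ->
  exists b : int, a = b ^+ p.
Proof.
move=> def_d; have [C def_C] := exists_Cyclotomic_matrix.
have [|u] := @norm_pth_power C d a%:P def_C.
  by rewrite map_polyC hornerC.
rewrite horner_mx_C det_scalar; apply: int_root_of_power; lia.
Qed.

(** The norm of [t + z ^+ i] divides a power of [t ^+ p + 1], because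
    [t + z ^+ i] divides [t ^+ p + (z ^+ i) ^+ p] for odd [p]; so it is prime
    to [r]. In [r ^+ p.-1 * N(t + z ^+ i)], a [p]-th power, the first factor is
    then a [p]-th power as well. *)
Lemma pth_power_of_twisted (r t : int) (d : L) (i : nat) : (r %| t)%Z ->
  d ^+ p = r%:~R * (t%:~R + z ^+ i) -> exists s : int, r = s ^+ p.
Proof.
move=> r_dvd_t def_d; have [C def_C] := exists_Cyclotomic_matrix.
pose A : {poly int} := t%:P + 'X^i.
have [|u] := @norm_pth_power C d (r%:P * A) def_C.
  by rewrite rmorphM rmorphD /= !map_polyC map_polyXn !hornerE.
rewrite rmorphM detM /= horner_mx_C det_scalar => def_u.
have coM : coprimez r (\det (horner_mx C A)).
  pose B := \sum_(j < p) ('X^i) ^+ (p.-1 - j) * (- t)%:P ^+ j : {poly int}.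
  pose S := ('X - 1) * \sum_(j < i) ('X^p : {poly int}) ^+ (i.-1 - j) * 1 ^+ j.
  have AB : A * B = 'X^(i * p) + (t ^+ p)%:P.
    rewrite /A -[t in t%:P]opprK polyCN addrC -subrXX -polyC_exp exprN_odd //.
    by rewrite polyCN opprK exprM.
  have : A * B - (1 + t ^+ p)%:P = S * 'Phi_p.
    rewrite AB polyCD opprD addrACA subrr addr0 /S mulrAC mulX1_Cyclotomic.
    have := subrXX ('X^p : {poly int}) 1 i.
    by rewrite expr1n -exprM [(p * i)%N]mulnC polyC1.
  rewrite -def_C => /horner_mx_congr/(congr1 determinant).
  rewrite rmorphM detM /= horner_mx_C det_scalar => def_M.
  rewrite coprimezE; apply: (@coprime_dvdr _ `|(1 + t ^+ p) ^+ p.-2.+1|%N).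
    by rewrite -def_M abszM dvdn_mulr.
  rewrite -coprimezE.
  apply: coprimezXr; apply/coprimezP.
  have /dvdzP[q def_t] := r_dvd_t.
  exists (- (q * t ^+ p.-1), 1) => /=.
  rewrite mul1r mulNr mulrAC -def_t -exprS prednK //.
  by rewrite addrC addrK.
have [v] := int_coprime_root p_odd (coprimezXl p.-2.+1 coM) def_u.
by apply: int_root_of_power; lia.
Qed.

Let evD P Q : ev (P + Q) = ev P + ev Q. Proof. by rewrite rmorphD hornerD. Qed.
Let evN P : ev (- P) = - ev P. Proof. by rewrite rmorphN hornerN. Qed.
Let evM P Q : ev (P * Q) = ev P * ev Q. Proof. by rewrite rmorphM hornerM. Qed.
Let evX P k : ev (P ^+ k) = ev P ^+ k. Proof. by rewrite rmorphXn horner_exp. Qed.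
Let evC (a : int) : ev a%:P = a%:~R. Proof. by rewrite map_polyC hornerC. Qed.
Let ev1 : ev 1 = 1. Proof. by rewrite rmorph1 hornerC. Qed.
Let evZ (a : int) P : ev (a *: P) = a%:~R * ev P.
Proof. by rewrite map_polyZ hornerZ. Qed.
Let evx : ev 'X = z. Proof. by rewrite map_polyX hornerX. Qed.
Let evE := (evD, evN, evM, evX, ev1, evC, evZ, evx).

(** Inverting [z - 1] inverts [p]: modulo [p], [(z - 1) ^+ p = z ^+ p - 1 = 0]. *)
Lemma pth_power_subX1 : exists W : {poly int}, (z - 1) ^+ p = p%:R * ev W.
Proof.
have [W def_W] := frobenius_poly ('X - 1) p_pr; exists W.
have : ev (('X - 1) ^+ p) = ev ((('X - 1) \Po 'X^p) + p%:Z *: W) by rewrite def_W.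
rewrite -polyC1 comp_polyB comp_polyX comp_polyC polyC1 !evE.
by rewrite (prim_expr_order z_prim) subrr add0r -pmulrn.
Qed.

(** Denominators can be written as a power of [z - 1] times an integer prime to
    [p]; the prime above [p] is thereby isolated. *)
Lemma local_fraction (d : L) : exists (P : {poly int}) (m e : nat),
  coprime p m /\ d * m%:R * (z - 1) ^+ e = ev P.
Proof.
have [P [m [m_gt0 def_P]]] := integral_fraction d.
have [m' co_m def_m] := pfactor_coprime p_pr m_gt0.
have [W def_W] := pth_power_subX1; set a := logn p m in def_m.
exists (P * W ^+ a), m', (p * a)%N; split => //.
rewrite !evE -def_P def_m exprM def_W exprMn.
by rewrite natrM natrX !mulrA.
Qed.

Lemma dvdz_pexp_prime (a : int) (k : nat) : (p %| a ^+ k)%Z -> (p %| a)%Z.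
Proof. by rewrite !dvdzE abszX Euclid_dvdX // => /andP[]. Qed.

(** Descent on the power [e] of [z - 1] in the denominator. If [e > 0] then the
    numerator satisfies [P(z) ^+ p = (z - 1) ^+ p * ...]; evaluation at [1] is
    well defined modulo [p] on [Z[z]], as ['Phi_p] takes the value [p] there, so
    [p] divides [P.[1]]. As [p] itself is a multiple of [z - 1], so is [P(z)],
    and one factor [z - 1] cancels. *)
Lemma local_integral_of_pth_power (d : L) (Q : {poly int}) : d ^+ p = ev Q ->
  exists (P : {poly int}) (m : nat), coprime p m /\ d * m%:R = ev P.
Proof.
move=> def_d; have [P [m [e [co_m]]]] := local_fraction d.
elim: e P => [|e IHe] P def_P; first by exists P, m; rewrite -def_P mulr1.
have [S def_S] : exists S,
    P ^+ p - (m%:Z ^+ p)%:P * Q * (('X - 1) ^+ e.+1) ^+ p = S * 'Phi_p.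
  apply: dvd_Cyclotomic.
  rewrite !evE -def_P -def_d rmorphXn /= -pmulrn.
  by rewrite !exprMn [_ * d ^+ p]mulrC; apply: subrr.
have p_dvd : (p %| P.[1])%Z.
  apply: (@dvdz_pexp_prime _ p).
  have := congr1 (fun R : {poly int} => R.[1]) def_S.
  have at1 : ('X - 1 : {poly int}).[1] = 0 by rewrite -polyC1 hornerXsubC subrr.
  rewrite /= !(at1, hornerD, hornerN, hornerM, horner_exp).
  rewrite Cyclotomic_at1 exprS mul0r expr0n gtn_eqF // mulr0 subr0 => ->.
  by rewrite dvdz_mull.
have /dvdzP[k def_k] := p_dvd.
have /factor_theorem[T def_T] : root ('Phi_p - p%:Z%:P) 1.
  by rewrite rootE hornerD hornerN hornerC Cyclotomic_at1 subrr.
have /factor_theorem[U def_U] : root (P - (k * p%:Z)%:P) 1.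
  by rewrite rootE hornerD hornerN hornerC def_k subrr.
apply: (IHe (U - k%:P * T)); apply: (mulIf subX1_neq0).
rewrite exprSr mulrA in def_P; rewrite def_P.
have ev_p : ev (T * ('X - 1)) = - p%:R.
  by rewrite -polyC1 -def_T !evE root_Cyclotomic add0r pmulrn.
have -> : P = U * ('X - 1) + (k * p%:Z)%:P by rewrite -[1]polyC1 -def_U subrK.
rewrite !evE in ev_p *; rewrite mulrBl -mulrA ev_p mulrN opprK.
by rewrite rmorphM /= -pmulrn.
Qed.

(** By Frobenius, the numerator [P] of a [p]-th root would satisfy
    [P(z) ^+ p = P(1)] modulo [p], so that ['Phi_p] would divide
    [a - b * 'X^i] modulo [p] for integers [a] and [b], with [b] prime to [p].
    But ['Phi_p] has [1] as a multiple root modulo [p], while the derivative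
    [- b * i] at [1] is nonzero modulo [p]. *)
Lemma not_pth_power_unit_shift (t : int) (i : nat) (d : L) :
  (0 < i < p)%N -> d ^+ p != t%:~R + z ^+ i.
Proof.
move=> /andP[i_gt0 i_ltp]; apply/eqP => def_d.
have [|P [m [co_m def_P]]] := @local_integral_of_pth_power d (t%:P + 'X^i).
  by rewrite !evE.
have [W def_W] := frobenius_poly P p_pr.
have [S def_S] : exists S,
    (P.[1] - m%:Z ^+ p * t)%:P - (m%:Z ^+ p) *: 'X^i + p%:Z *: W = S * 'Phi_p.
  apply: dvd_Cyclotomic.
  have : ev (P ^+ p) = m%:R ^+ p * (t%:~R + z ^+ i).
    by rewrite evX -def_P exprMn def_d mulrC.
  have -> : ev (P ^+ p) = (P.[1])%:~R + p%:~R * ev W.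
    rewrite def_W evD evZ map_comp_poly map_polyXn horner_comp hornerXn.
    rewrite (prim_expr_order z_prim); congr (_ + _).
    by have := horner_map (intr : int -> L) P 1; rewrite rmorph1.
  rewrite !evE rmorphB rmorphM !rmorphXn /= -!pmulrn => def_ev.
  by rewrite addrAC [X in X - _]addrAC def_ev mulrDr -addrA -opprD subrr.
have := congr1 (fun R : {poly int} => R^`().[1]) def_S.
rewrite /= derivD derivB derivM derivC !derivZ derivXn sub0r.
rewrite !(hornerD, hornerN, hornerM, hornerZ, hornerMn) hornerXn expr1n Cyclotomic_at1.
move=> def_i; suff: (p %| m%:Z ^+ p * i%:R)%Z.
  rewrite natz dvdzE abszM abszX Euclid_dvdM // Euclid_dvdX //.
  rewrite prime_coprime // in co_m; rewrite (negbTE co_m) /=.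
  by apply/negP; rewrite gtnNdvd.
have -> : m%:Z ^+ p * i%:R = p%:Z * W^`().[1] -
    (S^`().[1] * p%:Z + S.[1] * ('Phi_p)^`().[1]).
  by rewrite -def_i opprD opprK addrCA subrr addr0.
apply: rpredB; first exact: dvdz_mulr.
apply: rpredD; apply: dvdz_mull => //; exact: deriv_Cyclotomic_at1.
Qed.

End Cyclotomic.

(** * The critical orbit *)

Definition critical_orbit (R : pzSemiRingType) (p : nat) (c : R) (n : nat) : R :=
  iter n (fun x => x ^+ p + c) 0.

Lemma critical_orbitS (R : pzSemiRingType) (p : nat) (c : R) (n : nat) :
  critical_orbit p c n.+1 = critical_orbit p c n ^+ p + c.
Proof. by []. Qed.

Lemma poly_iter_at0 (R : comNzRingType) (p : nat) (c : R) (n : nat) :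
  (poly_iter (unicritical p c) n).[0] = critical_orbit p c n.
Proof.
elim: n => [|n IHn]; first by rewrite /= hornerX.
rewrite -[LHS]/((unicritical p c \Po poly_iter (unicritical p c) n).[0]).
by rewrite horner_comp IHn hornerD hornerXn hornerC.
Qed.

Lemma rmorph_critical_orbit (R S : pzSemiRingType) (f : {rmorphism R -> S})
    (p : nat) (c : R) (n : nat) :
  f (critical_orbit p c n) = critical_orbit p (f c) n.
Proof.
elim: n => [|n IHn]; first by rewrite /= rmorph0.
by rewrite !critical_orbitS rmorphD rmorphXn /= IHn.
Qed.

(** The whole orbit is divisible by [c], so each [x ^+ p + c] is [c] times a number
    that is [1] modulo [c]. *)
Lemma critical_orbit_coprime_factor (p : nat) (c : int) (n : nat) : (1 < p)%N ->
  exists b : int, critical_orbit p c n.+1 = c * b /\ coprimez c b.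
Proof.
move=> p_gt1.
have step q : (c * q) ^+ p + c = c * (c ^+ p.-1 * q ^+ p + 1).
  by rewrite exprMn mulrDr mulr1 mulrA -exprS prednK // ltnW.
have [q def_q] : exists q, critical_orbit p c n = c * q.
  elim: n => [|n [q def_q]]; first by exists 0; rewrite mulr0.
  by exists (c ^+ p.-1 * q ^+ p + 1); rewrite critical_orbitS def_q step.
exists (c ^+ p.-1 * q ^+ p + 1); split; first by rewrite critical_orbitS def_q step.
apply/coprimezP; exists (- (c ^+ p.-2 * q ^+ p), 1) => /=.
have -> : c ^+ p.-1 = c * c ^+ p.-2 by rewrite -exprS; congr (_ ^+ _); lia.
by rewrite mul1r mulNr mulrC -!mulrA addrA addNr add0r.
Qed.

Lemma expn_succ_gap (x k : nat) : (x ^ k.+2 + 2 * x + 1 <= x.+1 ^ k.+2)%N.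
Proof.
elim: k => [|k IHk]; first by rewrite !expnS !expn0; lia.
rewrite expnS [X in (_ <= X)%N]expnS.
move: IHk; set X := (x ^ _)%N; set Y := (x.+1 ^ _)%N; nia.
Qed.

(** With [A] the preceding orbit term, the left-hand side is
    [A ^ p + R ^ p + R]. Either [A = 0] and it lies strictly between the [p]-th
    powers of [R] and [R + 1], or [A >= R ^ p] and it lies strictly between
    those of [A] and [A + 1]. *)
Lemma critical_orbit_not_power (p R n v : nat) : (2 < p)%N -> (0 < R)%N ->
  (critical_orbit p (R ^ p)%N n.+1 + R)%N <> (v ^ p)%N.
Proof.
move=> p_gt2 R_gt0; rewrite critical_orbitS.
set A := critical_orbit p _ n; rewrite -[(_ ^+ _ + _)%R]/(A ^+ p + R ^ p)%N.
have -> : A ^+ p = (A ^ p)%N by elim: (p) => // k IHk; rewrite exprS IHk expnS.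
have A_large : A = 0%N \/ (R ^ p <= A)%N.
  rewrite /A; case: (n) => [|k]; [by left | right].
  by rewrite /= leq_addl.
have leRp : (R <= R ^ p)%N by rewrite -{1}[R]expn1 leq_pexp2l; lia.
have mono (x y : nat) : (x ^ p < y ^ p)%N = (x < y)%N by rewrite ltn_exp2r; lia.
have gap x : (x ^ p + 2 * x + 1 <= x.+1 ^ p)%N.
  have := expn_succ_gap x p.-2; have -> : p.-2.+2 = p by lia.
  by [].
move=> def_v; case: A_large => [A0|leA].
  rewrite A0 exp0n in def_v; last by lia.
  have lt1 : (R < v)%N by rewrite -mono -def_v; lia.
  have lt2 : (v < R.+1)%N by rewrite -mono -def_v; have := gap R; lia.
  lia.
have lt1 : (A < v)%N by rewrite -mono -def_v; lia.
have lt2 : (v < A.+1)%N by rewrite -mono -def_v; have := gap A; lia.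
lia.
Qed.

Lemma critical_orbitN (R : comNzRingType) (p : nat) (c : R) (n : nat) : odd p ->
  critical_orbit p (- c) n = - critical_orbit p c n.
Proof.
move=> p_odd; elim: n => [|n IHn]; first by rewrite oppr0.
by rewrite !critical_orbitS IHn exprN_odd // opprD.
Qed.

Lemma critical_orbit_Posz (p c n : nat) :
  critical_orbit p c%:Z n = (critical_orbit p c n)%:Z.
Proof.
elim: n => // n IHn; rewrite !critical_orbitS IHn PoszD; congr (_ + _).
by move: (critical_orbit p c n) => x; elim: (p) => // k IHk; rewrite !exprS IHk PoszM.
Qed.

(** Negating [r] negates the orbit and [p]-th powers alike, which reduces the
    claim to positive [r]. *)
Lemma critical_orbit_add_not_power (p : nat) (r b : int) (n : nat) :
  odd p -> (2 < p)%N -> r != 0 ->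
  critical_orbit p (r ^+ p) n.+1 + r <> b ^+ p.
Proof.
move=> p_odd p_gt2.
have posP (k : nat) (e : int) : (0 < k)%N ->
    critical_orbit p (k%:Z ^+ p) n.+1 + k%:Z <> e ^+ p.
  move=> k_gt0; rewrite -[k%:Z]natz -natrX !natz critical_orbit_Posz -PoszD.
  by move/(congr1 absz); rewrite abszX /=; apply: critical_orbit_not_power.
case: r => k r_neq0; first by apply: posP; case: k r_neq0.
rewrite NegzE exprN_odd // critical_orbitN // -opprD => /eqP.
by rewrite eqr_oppLR -exprN_odd // => /eqP; apply: posP.
Qed.

(** * Irreducibility over the two fields *)

Lemma map_poly_iter (R S : comNzRingType) (f : {rmorphism R -> S})
    (p : nat) (c : R) (n : nat) :
  map_poly f (poly_iter (unicritical p c) n) = poly_iter (unicritical p (f c)) n.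
Proof.
elim: n => [|n IHn]; first by rewrite /= map_polyX.
by rewrite !poly_iterS map_comp_poly IHn rmorphD /= map_polyXn map_polyC.
Qed.

Lemma irreducible_of_map (F K : fieldType) (f : {rmorphism F -> K}) (P : {poly F}) :
  irreducible_poly (map_poly f P) -> irreducible_poly P.
Proof.
move=> [P_gt1 P_irr]; split=> [|A A_neq1 dvdA].
  by rewrite size_map_poly in P_gt1.
by rewrite -(eqp_map f) P_irr ?dvdp_map // size_map_poly.
Qed.

Lemma eqp_irreducible (F : fieldType) (P Q : {poly F}) :
  P %= Q -> irreducible_poly P -> irreducible_poly Q.
Proof.
move=> eqPQ [P_gt1 P_irr]; split=> [|A A_neq1 dvdA].
  by rewrite -(eqp_size eqPQ).
by rewrite -(eqp_rtrans eqPQ) P_irr // (eqp_dvdr _ eqPQ).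
Qed.

Lemma critical_orbit_not_pth_power (p : nat) (L : fieldExtType rat) (z : L)
    (c : int) (n : nat) :
  prime p -> odd p -> cyclotomic_field p z -> ~ (exists r : int, c = r ^+ p) ->
  ~ (exists b : L, (poly_iter (unicritical p c%:~R) n.+1).[0] = b ^+ p).
Proof.
move=> p_pr p_odd cyc c_not_pow [b]; rewrite poly_iter_at0.
rewrite -(rmorph_critical_orbit (intr : int -> L)) => /esym def_b.
have [s def_s] := int_pth_power p_pr p_odd cyc def_b.
have [q [def_q co_q]] := critical_orbit_coprime_factor c n (prime_gt1 p_pr).
by apply: c_not_pow; apply: (int_coprime_root p_odd co_q); rewrite -def_q def_s.
Qed.

Lemma twisted_critical_orbit_not_pth_power (p : nat) (L : fieldExtType rat)
    (z : L) (r : int) (n i : nat) :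
  prime p -> odd p -> cyclotomic_field p z -> r != 0 -> (i < p)%N ->
  ~ (exists b : L, ('X + (r%:~R * z ^+ i)%:P).[
       (poly_iter (unicritical p (r ^+ p)%:~R) n.+1).[0]] = b ^+ p).
Proof.
move=> p_pr p_odd cyc r_neq0 i_ltp [b].
have p_gt2 := odd_prime_gt2 p_odd p_pr.
rewrite poly_iter_at0 -(rmorph_critical_orbit (intr : int -> L)) !hornerE => /esym.
(* For [i = 0] the value is the integer [a + r], compared with integer powers. *)
have [->|i_neq0] := eqVneq i 0%N.
  rewrite expr0 mulr1 -rmorphD /=.
  move/(int_pth_power p_pr p_odd cyc) => [s].
  exact: critical_orbit_add_not_power.
have [q [-> _]] := critical_orbit_coprime_factor (r ^+ p) n (prime_gt1 p_pr).
pose t := r ^+ p.-1 * q.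
have -> : r ^+ p * q = r * t by rewrite mulrA -exprS prednK // prime_gt0.
rewrite rmorphM /= -mulrDr => def_b.
have r_dvd_t : (r %| t)%Z by rewrite dvdz_mulr // dvdz_exp //; lia.
have [s def_r] := pth_power_of_twisted p_pr p_odd cyc r_dvd_t def_b.
have i_range : (0 < i < p)%N by rewrite lt0n i_neq0.
have /negP[] := not_pth_power_unit_shift p_pr p_odd cyc t (b / s%:~R) i_range.
rewrite expr_div_n def_b {1}def_r -rmorphXn /= -def_r mulrAC divff ?mul1r //.
by rewrite (intr_ext_eq0 L).
Qed.

Lemma unicritical_linear_factors (p : nat) (L : fieldType) (z r : L) :
  odd p -> p.-primitive_root z -> r != 0 ->
  unicritical p (r ^+ p) = \prod_(i < p) ('X + (r * z ^+ i)%:P).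
Proof.
move=> p_odd z_prim r_neq0.
pose rs := [seq - (r * z ^+ (i : 'I_p)) | i <- enum 'I_p].
have sz_rs : size rs = p by rewrite size_map size_enum_ord.
have f_monic : unicritical p (r ^+ p) \is monic by rewrite monicXnaddC ?odd_gt0.
rewrite (@all_roots_prod_XsubC _ (unicritical p (r ^+ p)) rs).
- rewrite (monicP f_monic) scale1r big_map big_enum /=.
  by apply: eq_bigr => i _; rewrite polyCN opprK.
- by rewrite sz_rs size_XnaddC ?odd_gt0.
- apply/allP => _ /mapP[i _ ->]; rewrite rootE !hornerE exprN_odd // exprMn.
  by rewrite exprAC (prim_expr_order z_prim) expr1n mulr1 addNr.
- rewrite uniq_rootsE map_inj_uniq ?enum_uniq // => i j /oppr_inj/(mulfI r_neq0)/eqP.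
  rewrite (eq_prim_root_expr z_prim) !modn_small ?ltn_ord // => /eqP.
  exact: val_inj.
Qed.

Lemma irreducible_linear (F : fieldType) (a b : F) : a != 0 ->
  irreducible_poly (a *: 'X - b%:P).
Proof.
move=> a_neq0; apply: eqp_irreducible (irredp_XsubC (a^-1 * b)).
rewrite eqp_sym (_ : _ - _ = a *: ('X - (a^-1 * b)%:P)) ?eqp_scale //.
by rewrite scalerBr -[_ *: _%:P]mul_polyC -polyCM mulVKf.
Qed.

(** The cofactor is a constant multiple of ['Phi_p \Po u] with [u = - 'X / r];
    Capelli's lemma with this linear [u] gives the irreducibility. *)
Lemma irreducible_unicritical_cofactor (p : nat) (r : int) (h : {poly int})
    (L : fieldExtType rat) (z : L) :
  prime p -> odd p -> cyclotomic_field p z -> r != 0 ->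
  unicritical p (r ^+ p) = ('X + r%:P) * h ->
  irreducible_poly (map_poly (intr : int -> rat) h).
Proof.
move=> p_pr p_odd cyc r_neq0 def_h.
have rQ_neq0 : r%:~R != 0 :> rat by rewrite intr_eq0.
pose u : {poly rat} := (- (r%:~R)^-1) *: 'X.
pose Phi := map_poly (intr : int -> rat) 'Phi_p.
have Phi_irr : irreducible_poly (Phi \Po u).
  have Phi_irr : irreducible_poly Phi by apply: irreducible_Cyclotomic.
  apply: (@capelli _ _ (in_alg L) Phi u z Phi_irr).
    have := root_Cyclotomic p_pr cyc; rewrite rootE => root_z.
    rewrite /Phi -map_poly_comp -{}[X in _ == X]root_z; apply/eqP; congr (_.[_]).
    by apply: eq_map_poly => a; apply: (rmorph_int (in_alg L)).
  rewrite map_polyZ map_polyX; apply: irreducible_linear.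
  by rewrite fmorph_eq0 oppr_eq0 invr_eq0.
apply: eqp_irreducible Phi_irr.
have X1_neq0 : u - 1 != 0.
  apply: irredp_neq0; rewrite -polyC1; apply: irreducible_linear.
  by rewrite oppr_eq0 invr_eq0.
rewrite -(eqp_mul2l _ _ X1_neq0).
have -> : (u - 1) * (Phi \Po u) = u ^+ p - 1.
  have := congr1 (fun P => map_poly (intr : int -> rat) P \Po u)
                 (mulX1_Cyclotomic p_pr).
  rewrite /= rmorphM comp_polyM !rmorphB /= map_polyX map_polyXn rmorph1.
  by rewrite -polyC1 !comp_polyC comp_polyX comp_Xn_poly.
have -> : u ^+ p - 1 =
    - (r%:~R ^- p) *: (map_poly intr ('X + r%:P) * map_poly intr h).
  rewrite -rmorphM -def_h rmorphD /= map_polyXn map_polyC /= rmorphXn /=.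
  rewrite exprZn exprN_odd // exprVn scalerDr; congr (_ + _).
  by rewrite -mul_polyC -polyCM mulNr mulVf ?expf_neq0 // polyCN.
have -> : u - 1 = - (r%:~R^-1) *: map_poly intr ('X + r%:P).
  rewrite rmorphD /= map_polyX map_polyC /= scalerDr; congr (_ + _).
  by rewrite -mul_polyC -polyCM mulNr mulVf // polyCN.
rewrite -scalerAl; apply: (@eqp_trans _ (map_poly intr ('X + r%:P) * map_poly intr h)).
  by apply: eqp_scale; rewrite oppr_eq0 invr_eq0 expf_neq0.
by rewrite eqp_sym eqp_scale // oppr_eq0 invr_eq0.
Qed.

Theorem corollary30 (p : nat) (c : int)
    (p_prime : prime p) (p_odd : odd p) (c_neq0 : c != 0) :
  (forall (L : fieldExtType rat) (zeta : L), cyclotomic_field p zeta ->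
     let f : {poly L} := unicritical p c%:~R in
     ((~ exists r : int, c = r ^+ p) -> stable_poly f)
     /\
     (forall r : int, c = r ^+ p ->
        let g (i : 'I_p) : {poly L} := 'X + (r%:~R * zeta ^+ i)%:P in
        f = \prod_(i < p) g i
        /\ (forall (n : nat) (i : 'I_p), (0 < n)%N ->
              irreducible_poly (g i \Po poly_iter f n))))
  /\
  (let f : {poly rat} := unicritical p c%:~R in
   ((~ exists r : int, c = r ^+ p) -> stable_poly f)
   /\
   (forall r : int, c = r ^+ p ->
      exists h : {poly int},
        let hQ : {poly rat} := map_poly intr h in
        [/\ unicritical p c = ('X + r%:P) * h,
            irreducible_poly hQ
          & forall n : nat, (0 < n)%N ->
              irreducible_poly (poly_iter f n + (r%:~R)%:P)
              /\ irreducible_poly (hQ \Po poly_iter f n)])).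
Proof.
have p_gt0 := prime_gt0 p_prime.
have stable_L (L : fieldExtType rat) (zeta : L) : cyclotomic_field p zeta ->
    (~ exists r : int, c = r ^+ p) -> stable_poly (unicritical p (c%:~R : L)).
  move=> cyc c_not_pow n _; rewrite -[poly_iter _ n]comp_polyX.
  apply: irreducible_comp_iter => //; first exact: monicX.
    by rewrite -['X]subr0 -polyC0; apply: irredp_XsubC.
  move=> k; rewrite hornerX.
  exact: (critical_orbit_not_pth_power p_prime p_odd cyc).
have irr_L (L : fieldExtType rat) (zeta : L) (r : int) (i n : nat) :
    cyclotomic_field p zeta -> c = r ^+ p -> (i < p)%N ->
    irreducible_poly (('X + (r%:~R * zeta ^+ i)%:P) \Po
                      poly_iter (unicritical p (c%:~R : L)) n).
  move=> cyc def_c i_ltp; have r_neq0 : r != 0.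
    by apply: contraNneq c_neq0 => r0; rewrite def_c r0 expr0n gtn_eqF.
  apply: irreducible_comp_iter => //; [exact: monicXaddC | exact: irredp_XaddC |].
  move=> k; rewrite def_c.
  exact: (twisted_critical_orbit_not_pth_power p_prime p_odd cyc r_neq0 i_ltp).
split=> [L zeta cyc f|f].
  split=> [|r def_c g]; first exact: (stable_L L zeta cyc).
  split=> [|n i _]; last exact: (irr_L L zeta r i n cyc def_c).
  rewrite /f def_c rmorphXn; apply: unicritical_linear_factors cyc.1 _ => //.
  rewrite (intr_ext_eq0 L).
  by apply: contraNneq c_neq0 => r0; rewrite def_c r0 expr0n gtn_eqF.
have [L [zeta cyc]] := cyclotomic_field_exists p_gt0.
have map_f n : map_poly (in_alg L) (poly_iter f n) = poly_iter (unicritical p c%:~R) n.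
  by rewrite map_poly_iter rmorph_int.
split=> [c_not_pow n n_gt0|r def_c].
  apply: (irreducible_of_map (f := in_alg L)); rewrite map_f.
  exact: (stable_L L zeta cyc).
have r_neq0 : r != 0.
  by apply: contraNneq c_neq0 => r0; rewrite def_c r0 expr0n gtn_eqF.
pose h : {poly int} := \sum_(j < p) 'X ^+ (p.-1 - j) * (- r)%:P ^+ j.
have def_h : unicritical p (r ^+ p) = ('X + r%:P) * h.
  rewrite -[r in 'X + r%:P]opprK polyCN -subrXX -polyC_exp exprN_odd //.
  by rewrite polyCN opprK.
have hQ_irr := irreducible_unicritical_cofactor p_prime p_odd cyc r_neq0 def_h.
exists h => hQ; split=> // [|n _]; first by rewrite def_c.
split.
  apply: (irreducible_of_map (f := in_alg L)).
  have rE : map_poly (in_alg L) (r%:~R)%:P = (r%:~R)%:P.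
    by rewrite map_polyC; congr (_%:P); apply: (rmorph_int (in_alg L)).
  rewrite rmorphD /= map_f rE.
  have := irr_L L zeta r 0%N n cyc def_c p_gt0.
  by rewrite expr0 mulr1 comp_polyD comp_polyX comp_polyC.
apply: (capelli (f := in_alg L) (x := - (r%:~R * zeta))) => //.
  (* [f] vanishes at [- r * zeta], and its factor ['X + r] does not. *)
  have rL_neq0 : r%:~R != 0 :> L by rewrite (intr_ext_eq0 L).
  have := congr1 (fun P => (map_poly (intr : int -> L) P).[- (r%:~R * zeta)]) def_h.
  rewrite /= rmorphM !rmorphD /= map_polyXn map_polyX !map_polyC !hornerE /=.
  rewrite exprN_odd // exprMn (prim_expr_order cyc.1) mulr1.
  rewrite rmorphXn addNr rootE map_in_alg_intr => /esym/eqP.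
  rewrite mulf_eq0 => /orP[|//].
  rewrite addrC -{1}[r%:~R]mulr1 -mulrBr mulf_eq0 (negPf rL_neq0) /=.
  by rewrite -oppr_eq0 opprB (negPf (subX1_neq0 p_prime cyc)).
have := irr_L L zeta r 1%N n cyc def_c (prime_gt1 p_prime).
by rewrite map_f expr1 comp_polyD comp_polyX comp_polyC polyCN opprK.
Qed.
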